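(* Assume $2^{\aleph_0}=\aleph_1$. Let $\mathbb{B}$ be a complete Boolean algebra satisfying the countable chain condition with $|\mathrm{End}(\mathbb{B})|\le\aleph_1$. If $\mathbb{B}$ is not atomic, then there exist two ultrafilters $U$ and $V$ on $\mathbb{B}$ such that $U\le_\mathrm{JPR}V$, $V\le_\mathrm{JPR}U$, $U\not\le_\mathrm{M}V$ and $V\not\le_\mathrm{M}U$.
   Context: $\mathbb{B}\upharpoonright b=\{a\in\mathbb{B}:a\le b\}$. $\mathrm{End}(\mathbb{B})$ is the set of all functions $h\colon\mathbb{B}\to\mathbb{B}$ for which there exists $b>\mathbb{0}$ such that $h\colon\mathbb{B}\to\mathbb{B}\upharpoonright b$ is a complete homomorphism. $\mathrm{Part}(\mathbb{B})$ is the set of maximal antichains; $B$ refines $A$ if every element of $B$ is below some element of $A$. M-ordering: $U\le_\mathrm{M}V$ iff there exist $v\in V$ and a complete homomorphism $h\colon\mathbb{B}\to\mathbb{B}\upharpoonright v$ with $U=h^{-1}[V]$. JPR-ordering: $U\le_\mathrm{JPR}V$ iff there exist $g\colon\mathrm{Part}(\mathbb{B})\to\mathrm{Part}(\mathbb{B})$ and, for each $A\in\mathrm{Part}(\mathbb{B})$, $f_A\colon g(A)\to A$ such that (1) for all $A$ and $X\subseteq A$: $\bigvee X\in U\iff\bigvee f_A^{-1}[X]\in V$; (2) whenever $B$ refines $A$, $\bigvee\{a\wedge b: a\in g(A), b\in g(B), f_B(b)\le f_A(a)\}\in V$. *)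

(* Defs.v *)
(* a Boolean algebra is a ctbDistrLatticeType
   (complemented distributive lattice with top and bottom). *)
From HB Require Import structures.
From mathcomp Require Import all_boot all_order.
From Stdlib Require Import ClassicalEpsilon Wellfounded.
Set Implicit Arguments. Unset Strict Implicit. Unset Printing Implicit Defensive.
Import Order.TTheory.
Local Open Scope order_scope.

Definition countable_set (T : Type) (S : T -> Prop) : Prop :=
  exists f : T -> nat, forall x y, S x -> S y -> f x = f y -> x = y.

Definition le_aleph1 (T : Type) : Prop :=
  exists R : T -> T -> Prop,
    well_founded R /\
    (forall x y z, R x y -> R y z -> R x z) /\
    (forall x y, R x y \/ x = y \/ R y x) /\
    (forall t, countable_set (fun s => R s t)).

(* The continuum hypothesis 2^aleph_0 = aleph_1
   (equivalently, since 2^aleph_0 >= aleph_1 always: 2^aleph_0 <= aleph_1). *)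
Definition CH : Prop := le_aleph1 (nat -> bool).

Section BA.
Context {disp : Order.disp_t} (B : ctbDistrLatticeType disp).

Definition is_ub (X : B -> Prop) (s : B) : Prop := forall x, X x -> x <= s.
Definition is_lub (X : B -> Prop) (s : B) : Prop :=
  is_ub X s /\ forall t, is_ub X t -> s <= t.

Definition complete : Prop := forall X : B -> Prop, exists s, is_lub X s.

(* the supremum \bigvee X (meaningful when B is complete) *)
Definition bsup (X : B -> Prop) : B := epsilon (inhabits (\bot : B)) (is_lub X).

Definition antichain (A : B -> Prop) : Prop :=
  (forall a, A a -> \bot < a) /\
  (forall a b, A a -> A b -> a <> b -> a `&` b = \bot).

Definition partition (A : B -> Prop) : Prop :=
  antichain A /\
  (forall A' : B -> Prop, antichain A' -> (forall a, A a -> A' a) ->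
     forall a, A' a -> A a).

Definition refines (A' A : B -> Prop) : Prop :=
  forall b, A' b -> exists a, A a /\ b <= a.

Definition ccc : Prop := forall A, antichain A -> countable_set A.

Definition atom (a : B) : Prop := \bot < a /\ forall c, \bot < c -> c <= a -> c = a.
Definition atomic : Prop := forall b, \bot < b -> exists a, atom a /\ a <= b.

(* h : B -> B|b is a complete homomorphism *)
Definition complete_hom_to (b : B) (h : B -> B) : Prop :=
  (forall x, h x <= b) /\
  h \top = b /\ h \bot = \bot /\
  (forall x y, h (x `&` y) = h x `&` h y) /\
  (forall x y, h (x `|` y) = h x `|` h y) /\
  (forall x, h (~` x) = b `&` ~` h x) /\
  (forall X : B -> Prop,
     h (bsup X) = bsup (fun y => exists x, X x /\ y = h x)).

Definition isEnd (h : B -> B) : Prop := exists b, \bot < b /\ complete_hom_to b h.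

Definition ultrafilter (U : B -> Prop) : Prop :=
  U \top /\ ~ U \bot /\
  (forall x y, U x -> x <= y -> U y) /\
  (forall x y, U x -> U y -> U (x `&` y)) /\
  (forall x, U x \/ U (~` x)).

Definition le_M (U V : B -> Prop) : Prop :=
  exists v h, V v /\ complete_hom_to v h /\ forall x, U x <-> V (h x).

Definition le_JPR (U V : B -> Prop) : Prop :=
  exists (g : (B -> Prop) -> (B -> Prop)) (f : (B -> Prop) -> B -> B),
    (forall A, partition A -> partition (g A)) /\
    (forall A, partition A -> forall b, g A b -> A (f A b)) /\
    (forall A, partition A -> forall X : B -> Prop, (forall x, X x -> A x) ->
       (U (bsup X) <-> V (bsup (fun b => g A b /\ X (f A b))))) /\
    (forall A A', partition A -> partition A' -> refines A' A ->
       V (bsup (fun c => exists a b, g A a /\ g A' b /\ f A' b <= f A a /\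
                                     c = a `&` b))).
End BA.

(* Main.v *)
(* Below an element without atoms take a disjoint sequence [a n] of nonzero elements.
   A condition is a pair [(u, v)] of sequences with [u n], [v n] below [a n] and
   with a common infinite support; conditions ordered by coordinatewise [<=] for
   almost all [n] are sigma-closed.  By CH and the chain condition there are at most
   [aleph_1] endomorphisms, elements and partitions, so a decreasing tower of
   conditions meets all the corresponding dense sets, and its two coordinates
   generate ultrafilters [U] and [V].

   For every partition [A], some [u] in the tower has each [u n] below a single
   element of [A], and likewise for [v].  Hence [U] and [V] are both determined by
   their traces on [a], which coincide, and this gives the two JPR reductions.
   Against an endomorphism [h], split every [u n] into nonzero parts inside and
   outside some [x]: as [h x] and [h (~` x)] are disjoint, [v] can be shrunk to
   avoid [h x] or [h (~` x)] on an infinite set, which forces [U <> h^-1 [V]]. *)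
Require Import Defs.
From mathcomp Require Import all_boot all_order.
From Stdlib Require Import Classical ClassicalEpsilon FunctionalExtensionality.
From Stdlib Require Import PropExtensionality Wellfounded.
Set Implicit Arguments. Unset Strict Implicit. Unset Printing Implicit Defensive.
Import Order.Theory.
Local Open Scope order_scope.

Lemma functional_choice_eps (S T : Type) (P : S -> T -> Prop) :
  (forall x, exists y, P x y) -> exists f, forall x, P x (f x).
Proof.
move=> ex_P; exists (fun x => proj1_sig (constructive_indefinite_description _ (ex_P x))).
by move=> x; case: constructive_indefinite_description.
Qed.

Definition asb (P : Prop) : bool := if excluded_middle_informative P then true else false.

Lemma asbP (P : Prop) : reflect P (asb P).
Proof. by rewrite /asb; case: excluded_middle_informative => H; constructor. Qed.

(** * Sets of size at most [aleph_1] *)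

Lemma le_aleph1_inj (S T : Type) (f : S -> T) :
  injective f -> le_aleph1 T -> le_aleph1 S.
Proof.
move=> f_inj [R [Rwf [Rtr [Rtot Rctb]]]]; exists (fun x y => R (f x) (f y)); split.
  exact: wf_inverse_image.
split; first by move=> x y z; apply: Rtr.
split=> [x y | t].
  by case: (Rtot (f x) (f y)) => [|[/f_inj|]]; auto.
have [e e_inj] := Rctb (f t); exists (fun x => e (f x)) => x y Rx Ry E.
exact/f_inj/e_inj.
Qed.

(* The order type of the initial segment below [t], transported to [nat],
   determines [t]: an isomorphism between two initial segments of a well-order
   cannot move a point strictly down. *)
Lemma le_aleph1_code (T : Type) :
  le_aleph1 T -> exists c : T -> nat -> nat -> bool, injective c.
Proof.
move=> [R [Rwf [Rtr [Rtot Rctb]]]].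
have [e e_inj] := functional_choice_eps Rctb.
(* The clause [s = s'] makes the coded order reflexive, so its diagonal records which numbers are
   values of [e t] below [t]. *)
pose code t m n := asb (exists s s', [/\ R s t, R s' t, s = s' \/ R s s',
                                      e t s = m & e t s' = n]).
exists code.
have Rirr x : ~ R x x by elim: (Rwf x) => {}x _ IH Rxx; exact: (IH x Rxx Rxx).
have key t t' : R t' t -> code t = code t' -> False.
  move=> Rt't E.
  have codeE m n : code t m n = code t' m n by rewrite E.
  have ex_s s : exists s', R s t -> R s' t' /\ e t' s' = e t s.
    have [Rs|nRs] := classic (R s t); last by exists s.
    have : code t (e t s) (e t s) by apply/asbP; exists s, s; split; auto.
    rewrite codeE => /asbP [s' [s'' [Rs' _ _ es' _]]].
    by exists s'.
  have [f fP] := functional_choice_eps ex_s.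
  have f_mono s s' : R s t -> R s' t -> R s s' -> R (f s) (f s').
    move=> Rs Rs' Rss'.
    have [Rfs efs] := fP s Rs; have [Rfs' efs'] := fP s' Rs'.
    have : code t (e t s) (e t s') by apply/asbP; exists s, s'; split; auto.
    rewrite codeE => /asbP [r [r' [Rr Rr' Rrr' er er']]].
    have rE : r = f s by apply: (e_inj t') => //; rewrite efs.
    have r'E : r' = f s' by apply: (e_inj t') => //; rewrite efs'.
    case: Rrr' => [rr'|]; last by rewrite rE r'E.
    have ss' : s = s' by apply: (e_inj t) => //; rewrite -efs -efs' -rE -r'E rr'.
    by case: (Rirr s); rewrite {2}ss'.
  have no_down s : R s t -> ~ R (f s) s.
    elim: (Rwf s) => {}s _ IH Rs Rfs.
    have Rfst := Rtr _ _ _ Rfs Rs.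
    exact: (IH (f s) Rfs Rfst (f_mono _ _ Rfst Rs Rfs)).
  (* The point [t'] lies below [t], and [f] sends it below itself. *)
  exact: (no_down t' Rt't (proj1 (fP t' Rt't))).
move=> t t' E; case: (Rtot t t') => [Rtt'|[//|Rt't]].
  by case: (key t' t Rtt').
by case: (key t t' Rt't).
Qed.

(** A point of [T] is coded by a binary relation on [nat], hence a sequence of points by a ternary
    one, that is, by a subset of [nat]; [CH] bounds those. *)
Lemma le_aleph1_seq (T : Type) : CH -> le_aleph1 T -> le_aleph1 (nat -> T).
Proof.
move=> ch /le_aleph1_code [c c_inj].
pose F (s : nat -> T) k :=
  if unpickle k is Some (l, m, n) then c (s l) m n else false.
apply: (@le_aleph1_inj _ _ F) ch => s s' E.
apply: functional_extensionality => l; apply: c_inj.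
apply: functional_extensionality => m; apply: functional_extensionality => n.
by have := congr1 (fun f => f (pickle (l, m, n))) E; rewrite /F pickleK.
Qed.

(** * Properties of almost all natural numbers *)

Definition ev (P : nat -> Prop) : Prop := exists N, forall n, (N <= n)%N -> P n.

Lemma ev_and (P Q : nat -> Prop) : ev P -> ev Q -> ev (fun n => P n /\ Q n).
Proof.
move=> [N NP] [M MQ]; exists (maxn N M) => n; rewrite geq_max => /andP[Nn Mn].
by split; auto.
Qed.

Lemma ev_imp (P Q : nat -> Prop) : (forall n, P n -> Q n) -> ev P -> ev Q.
Proof. by move=> PQ [N NP]; exists N => n /NP /PQ. Qed.

Lemma ev_true (P : nat -> Prop) : (forall n, P n) -> ev P.
Proof. by exists 0%N. Qed.

(** * Suprema and partitions *)

Section Algebra.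
Context {disp : Order.disp_t} (B : ctbDistrLatticeType disp).
Hypothesis Hcomplete : complete B.
Implicit Types (X A : B -> Prop) (x y z : B).

Lemma bsupP X : is_lub X (bsup X).
Proof. exact: epsilon_spec (Hcomplete X). Qed.

Lemma bsup_ub X x : X x -> x <= bsup X.
Proof. exact: (proj1 (bsupP X)). Qed.

Lemma bsup_le X y : is_ub X y -> bsup X <= y.
Proof. exact: (proj2 (bsupP X)). Qed.

(** Complementation moves [x] to the right: each [z] in [X] lies below the join of [s] and the
    complement of [x], hence so does [bsup X]. *)
Lemma meet_bsup x X : x `&` bsup X = bsup (fun y => exists z, X z /\ y = x `&` z).
Proof.
apply/eqP; rewrite eq_le; apply/andP; split; last first.
  by apply: bsup_le => _ [z [Xz ->]]; rewrite leI2 // bsup_ub.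
set s := (s in _ <= s).
suff le_s : bsup X <= ~` x `|` s.
  by apply: le_trans (leI2 (lexx x) le_s) _; rewrite meetUr meetxC join0x; exact: leIr.
apply: bsup_le => z Xz.
rewrite -[z](meetx1) -(joinxC x) meetUr leUx; apply/andP; split.
  by apply: lexU2; apply/orP; right; apply: bsup_ub; exists z; rewrite meetC.
by apply: lexU2; rewrite {1}leIr.
Qed.

(** Every nonzero [b] is thus the value at [\top] of an endomorphism, so a bound on endomorphisms
    also bounds the elements. *)
Lemma meet_isEnd b : \bot < b -> isEnd (fun x => b `&` x).
Proof.
move=> b0; exists b; split=> //; split; first by move=> x; rewrite leIl.
split; first exact: meetx1.
split; first exact: meetx0.
split; first by move=> x y; rewrite meetACA meetxx.
split; first by move=> x y; rewrite meetUr.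
split; first by move=> x; rewrite complI meetUr meetxC join0x.
by move=> X; rewrite meet_bsup.
Qed.

(** Otherwise [y] could be added to [A], against maximality. *)
Lemma partition_meets A y : Defs.partition A -> y != \bot -> exists2 a, A a & a `&` y != \bot.
Proof.
move=> [[A0 Adisj] Amax] y0; apply: NNPP => nmeet.
have disj a : A a -> a `&` y = \bot.
  by move=> Aa; apply/eqP/negPn/negP => ay; apply: nmeet; exists a.
have Ay : A y.
  apply: (Amax (fun a => A a \/ a = y)); [split | by left | by right].
    by move=> a [/A0 //| ->]; rewrite lt0x.
  move=> a b [Aa|->] [Ab|->] nab; [exact: Adisj | exact: disj | | by []].
  by rewrite meetC disj.
by apply: nmeet; exists y; rewrite ?meetxx.
Qed.

Lemma partition_of_meets A :
  antichain A -> (forall y, y != \bot -> exists2 a, A a & a `&` y != \bot) ->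
  Defs.partition A.
Proof.
move=> Aanti meets; split=> // A' [A'0 A'disj] AA' y A'y.
have [|a Aa ay] := meets y; first by rewrite -lt0x A'0.
have [<- //|nay] := classic (a = y).
by rewrite (A'disj a y (AA' a Aa) A'y nay) eqxx in ay.
Qed.

Lemma partition_inj A a b x : Defs.partition A -> A a -> A b ->
  x != \bot -> x <= a -> x <= b -> a = b.
Proof.
move=> [[_ Adisj] _] Aa Ab x0 xa xb; apply: NNPP => nab.
by move: x0; rewrite -lex0 -(Adisj a b Aa Ab nab) lexI xa xb.
Qed.

(** If [a] were not in [X], then [x] would be disjoint from every member of [X], hence from
    [bsup X]. *)
Lemma le_bsup_mem A X x a : Defs.partition A -> (forall y, X y -> A y) ->
  A a -> x != \bot -> x <= a -> x <= bsup X -> X a.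
Proof.
move=> Apart XA Aa x0 xa xX; apply: NNPP => nXa.
have : bsup X <= ~` x.
  apply: bsup_le => y Xy; rewrite lexC -disj_leC; apply/eqP.
  apply/eqP; apply: contraT => xy0; case: nXa.
  by rewrite (@partition_inj A a y (x `&` y)) ?leIr // ?(le_trans (leIl _ _)) //; exact: XA.
by move=> /(le_trans xX); rewrite -disj_leC meetxx (negbTE x0).
Qed.

(** A nonzero element outside both suprema would meet some [a] in [A], yet [a] lies below one of
    them. *)
Lemma compl_bsup_partition A X : Defs.partition A -> (forall y, X y -> A y) ->
  ~` bsup X = bsup (fun a => A a /\ ~ X a).
Proof.
move=> Apart XA; apply/eqP; rewrite eq_le; apply/andP; split; last first.
  apply: bsup_le => a [Aa nXa]; rewrite -disj_leC; apply: contraT => aX.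
  case: nXa; apply: (le_bsup_mem Apart XA Aa aX); [exact: leIl | exact: leIr].
rewrite -[X in _ <= X]complK -disj_leC; apply: contraT => y0.
have [a Aa] := partition_meets Apart y0; rewrite meetA.
have [Xa|nXa] := classic (X a).
  suff /eqP -> : a `&` ~` bsup X == \bot by rewrite meet0x eqxx.
  by rewrite disj_leC complK bsup_ub.
suff /eqP E : a `&` ~` bsup (fun a => A a /\ ~ X a) == \bot.
  by rewrite meetAC E meet0x eqxx.
by rewrite disj_leC complK bsup_ub.
Qed.

End Algebra.

(** * Pigeonhole and splitting below an atomless element *)

Lemma infinitely_often_or (P Q : nat -> Prop) :
  (forall N, exists2 n, (N <= n)%N & P n \/ Q n) ->
  (forall N, exists2 n, (N <= n)%N & P n) \/ (forall N, exists2 n, (N <= n)%N & Q n).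
Proof.
move=> PQ; have [|/not_all_ex_not [N nP]] := classic (forall N, exists2 n, (N <= n)%N & P n).
  by left.
right=> M; have [n] := PQ (maxn N M); rewrite geq_max => /andP[Nn Mn] [Pn|Qn].
  by case: nP; exists n.
by exists n.
Qed.

Lemma meet_or_compl {disp : Order.disp_t} (B : ctbDistrLatticeType disp) (x y : B) :
  x != \bot -> x `&` y != \bot \/ x `&` ~` y != \bot.
Proof.
move=> x0; have [xy|] := eqVneq (x `&` y) \bot; last by left.
right; have [xy'|//] := eqVneq (x `&` ~` y) \bot.
by move: x0; rewrite -[x]meetx1 -(joinxC y) meetUr xy xy' joinxx eqxx.
Qed.

Lemma atomless_split {disp : Order.disp_t} (B : ctbDistrLatticeType disp) (b x : B) :
  (forall y, y <= b -> ~ atom y) -> x <= b -> x != \bot ->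
  exists y, [/\ y <= x, y != \bot & x `&` ~` y != \bot].
Proof.
move=> no_atom xb x0; apply: NNPP => nsplit; apply: (no_atom x xb).
split=> [|y y0 yx]; first by rewrite lt0x.
apply/eqP; rewrite eq_le yx /=; rewrite -[y]complK -disj_leC.
by apply: contraT => xy; case: nsplit; exists y; rewrite -lt0x.
Qed.

(** Repeated splitting gives a strictly decreasing sequence [c] from [b]; its successive differences
    are nonzero and disjoint. *)
Lemma atomless_antichain {disp : Order.disp_t} (B : ctbDistrLatticeType disp) (b : B) :
  (forall y, y <= b -> ~ atom y) -> b != \bot ->
  exists a : nat -> B, [/\ forall n, a n <= b, forall n, a n != \bot &
                         forall m n, m <> n -> a m `&` a n = \bot].
Proof.
move=> no_atom b0.
have ex_split x : exists y, x <= b -> x != \bot -> [/\ y <= x, y != \bot & x `&` ~` y != \bot].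
  have [xb|] := boolP (x <= b); last by exists x.
  have [->|x0] := eqVneq x \bot; first by exists x.
  by have [y Hy] := atomless_split no_atom xb x0; exists y.
have [s sP] := functional_choice_eps ex_split.
pose c n := iter n s b.
have cP n : c n <= b /\ c n != \bot.
  elim: n => [//|n [cb c0]]; have [sc sc0 _] := sP _ cb c0.
  by split=> //=; exact: le_trans sc cb.
have c_anti m n : (m <= n)%N -> c n <= c m.
  move=> /subnK <-; elim: (n - m)%N => [//|k IH]; rewrite addSn.
  by have [cb c0] := cP (k + m)%N; have [sc _ _] := sP _ cb c0; exact: le_trans sc IH.
have lt_disj m n : (m < n)%N -> (c m `&` ~` c m.+1) `&` (c n `&` ~` c n.+1) = \bot.
  move=> mn; apply/eqP; rewrite disj_leC.
  apply: le_trans (leIr _ _) _; rewrite leC.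
  exact: le_trans (leIl _ _) (c_anti _ _ mn).
exists (fun n => c n `&` ~` c n.+1); split=> [n|n|m n /eqP].
- by have [cb _] := cP n; exact: le_trans (leIl _ _) cb.
- by have [cb c0] := cP n; have [_ _] := sP _ cb c0.
- by rewrite neq_ltn => /orP[mn|nm]; [|rewrite meetC]; exact: lt_disj.
Qed.

(** * Pairs of supports modulo finite *)

Section Conditions.
Context {disp : Order.disp_t} (B : ctbDistrLatticeType disp) (a : nat -> B).
Hypothesis a0 : forall n, a n != \bot.
Implicit Types (c d : bool -> nat -> B).

(* The two coordinates [c true] and [c false] approximate the two ultrafilters;
   the common support is what will make their traces on [a] coincide. *)
Definition cond c : Prop :=
  [/\ forall i n, c i n <= a n,
      forall i n, (c i n == \bot) = (c true n == \bot) &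
      forall N, exists2 n, (N <= n)%N & c true n != \bot].

Definition ext d c : Prop := ev (fun n => forall i, d i n <= c i n).

Lemma ext_refl c : ext c c.
Proof. by apply: ev_true. Qed.

Lemma ext_trans d c e : ext d c -> ext c e -> ext d e.
Proof.
move=> dc ce; apply: ev_imp (ev_and dc ce) => n [dcn cen] i.
exact: le_trans (dcn i) (cen i).
Qed.

Lemma ext_ev c d i (P : nat -> B -> Prop) : (forall n x y, x <= y -> P n y -> P n x) ->
  ext d c -> ev (fun n => P n (c i n)) -> ev (fun n => P n (d i n)).
Proof.
move=> Pdown dc cP; apply: ev_imp (ev_and dc cP) => n [dcn Pn].
exact: Pdown (dcn i) Pn.
Qed.

Lemma ext_ev_le c d i (x : B) :
  ext d c -> ev (fun n => c i n <= x) -> ev (fun n => d i n <= x).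
Proof.
by apply: (@ext_ev c d i (fun _ z => z <= x)) => n u v uv; exact: le_trans.
Qed.

Lemma cond_top : cond (fun _ => a).
Proof. by split=> // N; exists N. Qed.

Lemma cond_neq0 c i j n : cond c -> c i n != \bot -> c j n != \bot.
Proof. by move=> [_ supp _]; rewrite (supp i) (supp j). Qed.

(** The common tool for shrinking: wherever one of the two meets vanishes, both sequences are
    erased, which keeps the supports equal. *)
Lemma cond_thin c (m : bool -> nat -> B) : cond c ->
  (forall N, exists2 n, (N <= n)%N & forall j, c j n `&` m j n != \bot) ->
  exists d, [/\ cond d, ext d c & forall j n, d j n <= m j n].
Proof.
move=> [ca _ _] inf.
pose good n := [forall j, c j n `&` m j n != \bot].
exists (fun j n => if good n then c j n `&` m j n else \bot).
split=> [|| j n]; last by case: ifP => _; rewrite ?leIr ?le0x.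
  split=> [i n|i n|N].
  - by case: ifP => _; rewrite ?le0x // (le_trans (leIl _ _)).
  - by case: ifP => // /forallP cm; rewrite !(negbTE (cm _)).
  - by have [n Nn cm] := inf N; exists n => //; rewrite ifT //; apply/forallP.
by apply: ev_true => n i; case: ifP; rewrite ?leIl ?le0x.
Qed.

(** By maximality each nonzero [c i n] meets some [m n] in [A]; the other sequence is masked by
    [\top]. *)
Lemma cond_partition c i A : cond c -> Defs.partition A ->
  exists d, [/\ cond d, ext d c & ev (fun n => exists2 x, A x & d i n <= x)].
Proof.
move=> cc Apart.
have ex_m n : exists x, A x /\ (c i n != \bot -> c i n `&` x != \bot).
  have [->|cin] := eqVneq (c i n) \bot.
    by have [x Ax _] := partition_meets Apart (a0 0%N); exists x.
  have [x Ax xc] := partition_meets Apart cin.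
  by exists x; split=> // _; rewrite meetC.
have [m mP] := functional_choice_eps ex_m.
have [N|d [cd dc dm]] := @cond_thin c (fun j n => if j == i then m n else \top) cc.
  have [_ _ /(_ N) [n Nn cn]] := cc; exists n => // j.
  have [->|_] := eqVneq j i; last by rewrite meetx1 (cond_neq0 _ cc cn).
  exact: (proj2 (mP n)) (cond_neq0 _ cc cn).
exists d; split=> //; apply: ev_true => n; exists (m n); first exact: (proj1 (mP n)).
by have := dm i n; rewrite eqxx.
Qed.

(** Each nonzero [c i n] meets [x] or its complement, and one of the two happens infinitely
    often. *)
Lemma cond_decide c i x : cond c ->
  exists d, [/\ cond d, ext d c &
    ev (fun n => d i n <= x) \/ ev (fun n => d i n <= ~` x)].
Proof.
move=> cc.
have thin y : (forall N, exists2 n, (N <= n)%N & c i n `&` y != \bot) ->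
    exists d, [/\ cond d, ext d c & ev (fun n => d i n <= y)].
  move=> inf; have [N|d [cd dc dm]] := @cond_thin c (fun j n => if j == i then y else \top) cc.
    have [n Nn cy] := inf N; exists n => // j.
    have cn : c i n != \bot by apply: contra_neq cy => ->; rewrite meet0x.
    by have [->//|_] := eqVneq j i; rewrite meetx1 (cond_neq0 _ cc cn).
  exists d; split=> //; apply: ev_true => n.
  by have := dm i n; rewrite eqxx.
have [N|/thin [d [cd dc dx]]|/thin [d [cd dc dx]]] :=
    @infinitely_often_or (fun n => c i n `&` x != \bot) (fun n => c i n `&` ~` x != \bot).
- have [_ _ /(_ N) [n Nn cn]] := cc; exists n => //.
  exact: meet_or_compl (cond_neq0 _ cc cn).
- by exists d; split=> //; left.
- by exists d; split=> //; right.
Qed.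

Hypothesis Hcomplete : complete B.
Hypothesis a_disj : forall m n, m <> n -> a m `&` a n = \bot.
Hypothesis a_split : forall n x, x <= a n -> x != \bot ->
  exists y, [/\ y <= x, y != \bot & x `&` ~` y != \bot].

(** Split each [c i n] by some [y n] and join all the [y n]; since the [a n] are disjoint, no other
    [y k] touches [c i n]. *)
Lemma cond_split c i : cond c ->
  exists x, forall n, c i n != \bot -> c i n `&` x != \bot /\ c i n `&` ~` x != \bot.
Proof.
move=> cc; have [ca _ _] := cc.
have ex_y n : exists y, y <= c i n /\
    (c i n != \bot -> y != \bot /\ c i n `&` ~` y != \bot).
  have [->|cn] := eqVneq (c i n) \bot; first by exists \bot.
  by have [y [yc y0 cy]] := a_split (ca i n) cn; exists y.
have [y yP] := functional_choice_eps ex_y.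
exists (bsup (fun z => exists n, z = y n)) => n /[dup] cn /(proj2 (yP n)) [yn cyn].
split.
  rewrite -lt0x; apply: (@lt_le_trans _ _ (y n)); first by rewrite lt0x.
  by rewrite lexI (proj1 (yP n)) bsup_ub //; exists n.
suff le_y : c i n `&` ~` y n <= c i n `&` ~` bsup (fun z => exists n, z = y n).
  by rewrite -lt0x; apply: lt_le_trans le_y; rewrite lt0x.
rewrite lexI leIl /= lexC; apply: bsup_le => // _ [k ->].
have [->|/eqP nk] := eqVneq k n; first by rewrite lexC leIr.
rewrite -disj_leC -lex0 -(a_disj nk); apply: leI2.
  exact: le_trans (proj1 (yP k)) (ca i k).
exact: le_trans (leIl _ _) (ca i n).
Qed.

(* Since [h x] and [h (~` x)] are disjoint, each value of the other coordinate
   keeps a nonzero part off [h y] for [y = x] or [y = ~` x], and one choice of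
   [y] works infinitely often. *)
Lemma cond_avoid c i (h : B -> B) :
  cond c -> h \bot = \bot -> (forall x y, h (x `&` y) = h x `&` h y) ->
  exists d, [/\ cond d, ext d c &
    exists y, ev (fun n => d i n <= y) /\ ev (fun n => d (~~ i) n <= ~` h y)].
Proof.
move=> cc h0 hI; have [x xP] := cond_split i cc.
have thin y : (forall n, c i n != \bot -> c i n `&` y != \bot) ->
    (forall N, exists2 n, (N <= n)%N & c (~~ i) n `&` ~` h y != \bot) ->
    exists d, [/\ cond d, ext d c &
      exists y, ev (fun n => d i n <= y) /\ ev (fun n => d (~~ i) n <= ~` h y)].
  move=> cy inf.
  have [N|d [cd dc dm]] := @cond_thin c (fun j n => if j == i then y else ~` h y) cc.
    have [n Nn chy] := inf N; exists n => // j.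
    have cn : c (~~ i) n != \bot by apply: contra_neq chy => ->; rewrite meet0x.
    have [->|ji] := eqVneq j i; first exact: cy (cond_neq0 _ cc cn).
    by have -> : j = ~~ i by case: j i ji {cy inf chy cn xP} => [] [].
  exists d; split=> //; exists y; split; apply: ev_true => n.
    by have := dm i n; rewrite eqxx.
  by have := dm (~~ i) n; rewrite ifN //; case: (i).
have [N|/thin|/thin] := @infinitely_often_or
    (fun n => c (~~ i) n `&` ~` h x != \bot) (fun n => c (~~ i) n `&` ~` h (~` x) != \bot).
- have [_ _ /(_ N) [n Nn cn]] := cc; exists n => //.
  have [hx|] := eqVneq (c (~~ i) n `&` ~` h x) \bot; [right | by left].
  have [hx'|//] := eqVneq (c (~~ i) n `&` ~` h (~` x)) \bot.
  have : c (~~ i) n != \bot := cond_neq0 _ cc cn.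
  rewrite -lex0 -h0 -(meetxC x) hI lexI.
  by rewrite -[h x]complK -[h (~` x)]complK -!disj_leC hx hx' eqxx.
- by apply=> n /xP[].
- by apply=> n /xP[].
Qed.

(** A diagonal argument: [d k] bounds the members of index below [k], and its value is kept only at
    places [m k] of its support where these bounds already hold. *)
Lemma cond_lower_bound (I : Type) (S : I -> Prop) (p : I -> bool -> nat -> B) :
  countable_set S -> (forall s, S s -> cond (p s)) ->
  (forall s t, S s -> S t -> ext (p s) (p t) \/ ext (p t) (p s)) ->
  exists d, cond d /\ forall s, S s -> ext d (p s).
Proof.
move=> [e e_inj] pc chain.
(* Recording that [d] is a member of the chain or the top condition keeps it comparable with the
   next member. *)
have step k : exists d, cond d /\ ((exists2 s, S s & d = p s) \/ d = fun _ => a) /\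
    ev (fun n => forall s, S s -> (e s < k)%N -> forall i, d i n <= p s i n).
  elim: k => [|k [d [cd [dS [N dN]]]]].
    by exists (fun _ => a); split; [exact: cond_top | split; [right | exact: ev_true]].
  have [[s [Ss es]]|no_s] := classic (exists s, S s /\ e s = k); last first.
    exists d; split=> //; split=> //; exists N => n Nn s Ss; rewrite ltnS leq_eqVlt.
    by case/orP=> [/eqP es|]; [case: no_s; exists s | exact: dN].
  have [dp|pd] : ext d (p s) \/ ext (p s) d.
    case: dS => [[r Sr ->]|->]; first exact: chain.
    by right; apply: ev_true => n i; have [pa _ _] := pc s Ss.
  - exists d; split=> //; split=> //.
    apply: ev_imp (ev_and dp (ex_intro _ N dN)) => n [dpn dn] r Sr.
    rewrite ltnS leq_eqVlt => /orP[/eqP er|]; last exact: dn.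
    by have -> : r = s by apply: e_inj => //; rewrite er es.
  - exists (p s); split; first exact: pc.
    split; first by left; exists s.
    apply: ev_imp (ev_and pd (ex_intro _ N dN)) => n [pdn dn] r Sr.
    rewrite ltnS leq_eqVlt => /orP[/eqP er|er] i.
      by have -> : r = s by apply: e_inj => //; rewrite er es.
    exact: le_trans (pdn i) (dn r Sr er i).
have [d dP] := functional_choice_eps step.
have ex_m k : exists n, [/\ (k <= n)%N, d k true n != \bot &
    forall s, S s -> (e s < k)%N -> forall i, d k i n <= p s i n].
  have [[_ _ inf] [_ [N dN]]] := dP k; have [n] := inf (maxn k N).
  by rewrite geq_max => /andP[kn Nn] dn; exists n; split=> //; exact: dN.
have [m mP] := functional_choice_eps ex_m.
(* [m] may repeat values, so [kap] picks one index for each; off the range of [m] the test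
   [m (kap n) == n] fails. *)
have ex_k n : exists k, (exists l, m l = n) -> m k = n.
  by have [[l ml]|no_l] := classic (exists l, m l = n); [exists l | exists 0%N].
have [kap kapP] := functional_choice_eps ex_k.
(* As [k <= m k], every value of [m] is attained finitely often, so [kap]
   tends to infinity along the range of [m]. *)
exists (fun i n => if m (kap n) == n then d (kap n) i n else \bot); split.
  split=> [i n|i n|N].
  - by case: ifP; rewrite ?le0x //; have [[da _ _] _] := dP (kap n).
  - by case: ifP => // _; have [[_ ds _] _] := dP (kap n); exact: ds.
  - have [Nm _ _] := mP N; exists (m N) => //.
    have E : m (kap (m N)) = m N by apply: kapP; exists N.
    by rewrite E eqxx -{2}E; have [] := mP (kap (m N)).
(* Past every [m j] with [j <= e s], the equality [m (kap n) = n] forces [e s < kap n]. *)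
move=> s Ss; exists (\max_(j < (e s).+1) m j).+1 => n max_n i.
case: eqP => [E|_]; last exact: le0x.
rewrite -{2 3}E; have [_ _ -> //] := mP (kap n).
rewrite ltnNge; apply/negP => le_es; move: max_n; rewrite ltnNge -{1}E => /negP; apply.
exact: (leq_bigmax (Ordinal (le_es : (kap n < (e s).+1)%N))).
Qed.

(** Recursion along the well-order of [T]: the predecessors of [t] are countable, so their
    conditions have a lower bound, which is then extended into [D t]. *)
Lemma cond_tower (T : Type) (D : T -> (bool -> nat -> B) -> Prop) :
  le_aleph1 T ->
  (forall t c, cond c -> exists d, [/\ cond d, ext d c & D t d]) ->
  exists p : T -> bool -> nat -> B,
    [/\ forall t, cond (p t), forall t, D t (p t) &
        forall s t, ext (p s) (p t) \/ ext (p t) (p s)].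
Proof.
move=> [R [Rwf [Rtr [Rtot Rctb]]]] dense.
pose next t (rec : forall s, R s t -> bool -> nat -> B) :=
  epsilon (inhabits (fun _ => a))
    (fun d => [/\ cond d, D t d & forall s (Rs : R s t), ext d (rec s Rs)]).
pose p := Fix Rwf (fun _ => bool -> nat -> B) next.
have pE t : p t = next t (fun s _ => p s).
  rewrite /p Fix_eq // => {}t f g fg; congr (next t).
  by apply: functional_extensionality_dep => s; apply: functional_extensionality_dep => Rs.
have pP t : [/\ cond (p t), D t (p t) & forall s, R s t -> ext (p t) (p s)].
  elim: (Rwf t) => {}t _ IH.
  suff : exists d, [/\ cond d, D t d & forall s (_ : R s t), ext d (p s)].
    by move=> /(epsilon_spec (inhabits (fun _ => a))); rewrite -[epsilon _ _]/(next t _) -pE.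
  have [s Rs|r s Rr Rs|d [cd dp]] := @cond_lower_bound _ (fun s => R s t) p (Rctb t).
  - by have [] := IH s Rs.
  - have [_ _ pr] := IH r Rr; have [_ _ ps] := IH s Rs.
    case: (Rtot r s) => [|[->|]]; [by right; exact: ps | by left; exact: ext_refl |].
    by left; exact: pr.
  - have [d' [cd' dd' Dd']] := dense t d cd; exists d'; split=> // s Rs.
    exact: ext_trans dd' (dp s Rs).
exists p; split=> [t|t|s t]; try by have [] := pP t.
have [_ _ ps] := pP s; have [_ _ pt] := pP t.
by case: (Rtot s t) => [/pt|[->|/ps]]; [right | left; exact: ext_refl | left].
Qed.

End Conditions.

(** * The two ultrafilters *)

Section TowerFilter.
Context {disp : Order.disp_t} (B : ctbDistrLatticeType disp) (a : nat -> B).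
Context (T : Type) (p : T -> bool -> nat -> B).
Hypothesis Hcomplete : complete B.
Hypothesis a0 : forall n, a n != \bot.
Hypothesis a_disj : forall m n, m <> n -> a m `&` a n = \bot.
Hypothesis p_cond : forall t, cond a (p t).
Hypothesis p_chain : forall s t, ext (p s) (p t) \/ ext (p t) (p s).

(** Completes the range of [a] to a maximal antichain; it serves as [g A] for every [A]. *)
Definition spine (x : B) : Prop :=
  (exists n, x = a n) \/ x = ~` bsup (fun y => exists n, y = a n) /\ x != \bot.

Lemma spine_partition : Defs.partition spine.
Proof.
have rest_disj n : a n `&` ~` bsup (fun y => exists n, y = a n) = \bot.
  by apply/eqP; rewrite disj_leC complK bsup_ub //; exists n.
apply: partition_of_meets.
  split=> [x [[n ->]|[_]]|x y]; rewrite ?lt0x //.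
  move=> [[m ->]|[-> _]] [[n ->]|[-> _]] //.
  - by move=> ne; apply: a_disj => mn; apply: ne; rewrite mn.
  - by move=> _; rewrite meetC.
move=> y y0; have [[n ny]|no_n] := classic (exists n, a n `&` y != \bot).
  by exists (a n) => //; left; exists n.
suff y_rest : y <= ~` bsup (fun y => exists n, y = a n).
  exists (~` bsup (fun y => exists n, y = a n)); last by rewrite meetC (meet_idPl y_rest).
  by right; split=> //; rewrite -lt0x; apply: lt_le_trans y_rest; rewrite lt0x.
rewrite lexC; apply: bsup_le => // _ [n ->]; rewrite -disj_leC.
by apply: contraT => ny; case: no_n; exists n.
Qed.

Definition spine_index (x : B) : nat := epsilon (inhabits 0%N) (fun n => x = a n).

Lemma spine_indexK : cancel a spine_index.
Proof.
move=> n; have /esym : a n = a (spine_index (a n)).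
  by apply: (epsilon_spec _ (fun m => a n = a m)); exists n.
move=> E; apply: NNPP => /a_disj; rewrite E meetxx => /eqP.
by rewrite (negbTE (a0 n)).
Qed.

(** The filter generated by the suprema of the tails of the sequences [p t i]. *)
Definition tower_filter (i : bool) (x : B) : Prop :=
  exists t, ev (fun n => p t i n <= x).

Lemma tower_directed s t : exists r, ext (p r) (p s) /\ ext (p r) (p t).
Proof.
by case: (p_chain s t) => H; [exists s | exists t]; split=> //; exact: ext_refl.
Qed.

Lemma tower_common i j (P Q : nat -> B -> Prop) :
  (forall n x y, x <= y -> P n y -> P n x) -> (forall n x y, x <= y -> Q n y -> Q n x) ->
  (exists t, ev (fun n => P n (p t i n))) -> (exists t, ev (fun n => Q n (p t j n))) ->
  exists t, ev (fun n => P n (p t i n) /\ Q n (p t j n)).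
Proof.
move=> Pdown Qdown [s sP] [t tQ]; have [r [rs rt]] := tower_directed s t; exists r.
by apply: ev_and; [apply: ext_ev rs sP | apply: ext_ev rt tQ].
Qed.

Lemma tower_filter_ultra i : inhabited T ->
  (forall x, x != \bot -> exists t,
     ev (fun n => p t i n <= x) \/ ev (fun n => p t i n <= ~` x)) ->
  ultrafilter (tower_filter i).
Proof.
move=> [t0] decide; split; first by exists t0; apply: ev_true => n; exact: lex1.
split.
  move=> [t [N tN]]; have [_ _ /(_ N) [n Nn tn]] := p_cond t.
  have := tN n Nn; rewrite lex0 => /eqP tn0.
  by have := cond_neq0 i (p_cond t) tn; rewrite tn0 eqxx.
split.
  by move=> x y [t tx] xy; exists t; apply: ev_imp tx => n txn; exact: le_trans xy.
split.
  move=> x y Ux Uy.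
  have [||t tP] := @tower_common i i (fun _ z => z <= x) (fun _ z => z <= y) _ _ Ux Uy;
    try by move=> _ u v uv; exact: le_trans.
  by exists t; apply: ev_imp tP => n [? ?]; rewrite lexI; apply/andP.
move=> x; have [->|x0] := eqVneq x \bot.
  by right; exists t0; apply: ev_true => n; rewrite compl0 lex1.
by have [t [tx|tx]] := decide x x0; [left | right]; exists t.
Qed.

Hypothesis p_partition : forall A i, Defs.partition A ->
  exists t, ev (fun n => exists2 x, A x & p t i n <= x).

(* Along the tower, the i-th coordinate picks one element of [A] below each
   [a n], so [a] carries all the information, and both coordinates induce the
   same ultrafilter on [a]. *)
Lemma tower_filter_JPR i j :
  ultrafilter (tower_filter i) -> ultrafilter (tower_filter j) ->
  le_JPR (tower_filter i) (tower_filter j).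
Proof.
move=> Uultra Vultra.
have ex_phi A : exists phi : nat -> B, Defs.partition A ->
    (forall n, A (phi n)) /\ exists t, ev (fun n => p t i n <= phi n).
  have [Apart|] := classic (Defs.partition A); last by exists a.
  have [t [N tN]] := p_partition i Apart.
  (* Indices below [N] get an arbitrary member of [A], so that all values of [phi] lie in [A]. *)
  have ex_x n : exists x, A x /\ ((N <= n)%N -> p t i n <= x).
    have [/tN[x Ax tx]|_] := leqP N n; first by exists x.
    by have [x Ax _] := partition_meets Apart (a0 0%N); exists x.
  have [phi phiP] := functional_choice_eps ex_x.
  by exists phi => _; split=> [n|]; [|exists t, N => n]; have [] := phiP n.
have [phi phiP] := functional_choice_eps ex_phi.
(* On the support, [p t i n] is nonzero and below both [phi A n] and [bsup X], so [phi A n] is in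
   [X]; the common support lets [p t j n] follow. *)
have transfer A X : Defs.partition A -> (forall x, X x -> A x) ->
    tower_filter i (bsup X) ->
    tower_filter j (bsup (fun b => spine b /\ X (phi A (spine_index b)))).
  move=> Apart XA UX; have [Aphi Uphi] := phiP A Apart.
  have [||t tP] := @tower_common i i (fun n z => z <= phi A n) (fun _ z => z <= bsup X) _ _ Uphi UX;
    try by move=> n u v uv; exact: le_trans.
  exists t; apply: ev_imp tP => n [tphi tX].
  have [->|tn] := eqVneq (p t j n) \bot; first exact: le0x.
  have [ta _ _] := p_cond t; apply: le_trans (ta j n) _; apply: bsup_ub => //.
  split; first by left; exists n.
  rewrite spine_indexK; apply: (le_bsup_mem Hcomplete Apart XA (Aphi n) _ tphi tX).
  exact: (cond_neq0 i (p_cond t) tn).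
exists (fun _ => spine), (fun A b => phi A (spine_index b)); split.
  by move=> A _; exact: spine_partition.
split; first by move=> A /phiP [Aphi _] b _; exact: Aphi.
split.
  move=> A Apart X XA; split; first exact: transfer.
  (* The converse is [transfer] applied to the complement of [bsup X]. *)
  move=> VX; have [_ [_ [_ [_ Udec]]]] := Uultra.
  have [//|] := Udec (bsup X).
  rewrite (compl_bsup_partition Hcomplete Apart XA) => /transfer-/(_ A Apart) VnX.
  have [_ [V0 [Vup [VI _]]]] := Vultra.
  case: V0; apply: (Vup _ _ (VI _ _ VX (VnX _))); first by move=> x [].
  rewrite lex0 disj_leC (compl_bsup_partition Hcomplete spine_partition); last first.
    by move=> x [].
  apply: bsup_le => // b [sb Xb]; apply: bsup_ub => //; split=> //.
  by move=> [_ [_ nX]]; exact: nX.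
move=> A A' Apart A'part A'A.
have [Aphi Uphi] := phiP A Apart; have [A'phi U'phi] := phiP A' A'part.
have [||t tP] := @tower_common i i (fun n z => z <= phi A n) (fun n z => z <= phi A' n)
    _ _ Uphi U'phi; try by move=> n u v uv; exact: le_trans.
exists t; apply: ev_imp tP => n [tA tA'].
have [->|tn] := eqVneq (p t j n) \bot; first exact: le0x.
have [ta _ _] := p_cond t; apply: le_trans (ta j n) _; apply: bsup_ub => //.
(* Both [phi A n] and the member of [A] above [phi A' n] lie above the nonzero [p t i n], so they
   coincide. *)
exists (a n), (a n); split; first by left; exists n.
split; first by left; exists n.
rewrite spine_indexK meetxx; split=> //.
have [x [Ax A'x]] := A'A _ (A'phi n).
suff -> : phi A n = x by [].
apply: (partition_inj Apart (Aphi n) Ax _ tA (le_trans tA' A'x)).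
exact: (cond_neq0 i (p_cond t) tn).
Qed.

End TowerFilter.

(** Codes partitions by sequences of endomorphisms: [A] is countable by the chain condition, and
    each member is some [h \top]. *)
Lemma partition_range_End {disp : Order.disp_t} (B : ctbDistrLatticeType disp) (A : B -> Prop) :
  complete B -> ccc B -> (exists b : B, b != \bot) -> Defs.partition A ->
  exists F : nat -> {h : B -> B | isEnd h}, A = fun x => exists k, x = sval (F k) \top.
Proof.
move=> Hcomplete Hccc [b b0] Apart.
have [[A0 _] _] := Apart; have [e e_inj] := Hccc A (proj1 Apart).
have End_of x : A x -> exists h : {h : B -> B | isEnd h}, sval h \top = x.
  move=> /A0 x0; exists (exist _ _ (meet_isEnd Hcomplete x0)); exact: meetx1.
have [x0 Ax0 _] := partition_meets Apart b0; have [h0 h0E] := End_of x0 Ax0.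
have ex_h k : exists h : {h : B -> B | isEnd h}, A (sval h \top) /\
    forall x, A x -> e x = k -> sval h \top = x.
  have [[x [Ax ex]]|no_x] := classic (exists x, A x /\ e x = k).
    have [h hE] := End_of x Ax; exists h; rewrite hE; split=> // y Ay ey.
    by apply: e_inj => //; rewrite ex.
  by exists h0; rewrite h0E; split=> // x Ax ex; case: no_x; exists x.
have [F FP] := functional_choice_eps ex_h; exists F.
apply: functional_extensionality => x; apply: propositional_extensionality.
split=> [Ax|[k ->]]; last by have [] := FP k.
by exists (e x); have [_ /(_ x Ax erefl)] := FP (e x).
Qed.

(** * The dense sets, the tower and its two ultrafilters *)

Theorem mainTheorem8 (HCH : CH) (disp : Order.disp_t)
  (B : ctbDistrLatticeType disp)
  (Hcomplete : complete B) (Hccc : ccc B)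
  (Hend : le_aleph1 {h : B -> B | isEnd h})
  (Hnatomic : ~ atomic B) :
  exists U V : B -> Prop,
    ultrafilter U /\ ultrafilter V /\
    le_JPR U V /\ le_JPR V U /\ ~ le_M U V /\ ~ le_M V U.
Proof.
have [b [b0 no_atom]] : exists b : B, b != \bot /\ forall y, y <= b -> ~ atom y.
  apply: NNPP => no_b; apply: Hnatomic => b b0; apply: NNPP => no_y.
  apply: no_b; exists b; rewrite -lt0x; split=> // y yb y_atom.
  by apply: no_y; exists y.
have [a [ab a0 a_disj]] := atomless_antichain no_atom b0.
have a_split n x : x <= a n -> x != \bot ->
    exists y, [/\ y <= x, y != \bot & x `&` ~` y != \bot].
  by move=> xa; apply: (atomless_split no_atom); exact: le_trans (ab n).
pose E := {h : B -> B | isEnd h}.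
(* One task [F : nat -> E] carries the partition [{F k \top | k}], the element
   [F 0 \top] and the endomorphism [F 0]. *)
pose D1 (F : nat -> E) (i : bool) (c : bool -> nat -> B) :=
  Defs.partition (fun x => exists k, x = sval (F k) \top) ->
  ev (fun n => exists2 x, (exists k, x = sval (F k) \top) & c i n <= x).
pose D2 (F : nat -> E) (i : bool) (c : bool -> nat -> B) :=
  ev (fun n => c i n <= sval (F 0%N) \top) \/ ev (fun n => c i n <= ~` sval (F 0%N) \top).
pose D3 (F : nat -> E) (i : bool) (c : bool -> nat -> B) :=
  exists y, ev (fun n => c i n <= y) /\ ev (fun n => c (~~ i) n <= ~` sval (F 0%N) y).
pose D F c := forall i, [/\ D1 F i c, D2 F i c & D3 F i c].
(* Tasks persist under extension, so the two coordinates can be treated one after the other. *)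
have D_ext F i c d : ext d c -> [/\ D1 F i c, D2 F i c & D3 F i c] ->
    [/\ D1 F i d, D2 F i d & D3 F i d].
  move=> dc [D1c D2c [y [yc hyc]]]; split.
  - move=> /D1c; apply: (@ext_ev _ _ _ _ _ (fun _ z => exists2 x, _ & z <= x) _ dc).
    by move=> n u v uv [x Ax vx]; exists x => //; exact: le_trans vx.
  - by case: D2c => /(ext_ev_le dc); [left | right].
  - by exists y; split; apply: ext_ev_le dc _.
have dense_i F i c : cond a c ->
    exists d, [/\ cond a d, ext d c & [/\ D1 F i d, D2 F i d & D3 F i d]].
  move=> cc.
  have [d1 [cd1 dc1 H1]] : exists d, [/\ cond a d, ext d c & D1 F i d].
    have [Apart|nA] := classic (Defs.partition (fun x => exists k, x = sval (F k) \top)).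
      by have [d [cd dc dA]] := cond_partition a0 i cc Apart; exists d; split.
    by exists c; split=> //; exact: ext_refl.
  have [d2 [cd2 dc2 H2]] := cond_decide i (sval (F 0%N) \top) cd1.
  have [v [_ [_ [_ [h0 [hI _]]]]]] := proj2_sig (F 0%N).
  have [d3 [cd3 dc3 H3]] := cond_avoid Hcomplete a_disj a_split i cd2 h0 hI.
  exists d3; split=> //; first exact: ext_trans dc3 (ext_trans dc2 dc1).
  split=> //.
    move=> /H1; apply: (@ext_ev _ _ _ _ _ (fun _ z => exists2 x, _ & z <= x)); last first.
      exact: ext_trans dc3 dc2.
    by move=> n u w uw [x Ax wx]; exists x => //; exact: le_trans wx.
  by case: H2 => /(ext_ev_le dc3); [left | right].
have dense F c : cond a c -> exists d, [/\ cond a d, ext d c & D F d].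
  move=> cc; have [d [cd dc Dd]] := dense_i F true c cc.
  have [d' [cd' dc' Dd']] := dense_i F false d cd.
  exists d'; split=> //; first exact: ext_trans dc' dc.
  by case=> //; exact: D_ext Dd.
have [p [p_cond pD p_chain]] := cond_tower a0 (le_aleph1_seq HCH Hend) dense.
have E_of x : x != \bot -> exists h : E, sval h \top = x.
  rewrite -lt0x => x0; exists (exist _ _ (meet_isEnd Hcomplete x0)); exact: meetx1.
have ultra i : ultrafilter (tower_filter p i).
  have [h _] := E_of b b0; apply: (tower_filter_ultra p_cond p_chain (inhabits (fun=> h))).
  move=> x x0; have [g gE] := E_of x x0; exists (fun=> g).
  by have [_] := pD (fun=> g) i; rewrite /D2 gE.
have JPR i j : le_JPR (tower_filter p i) (tower_filter p j).
  apply: (tower_filter_JPR Hcomplete a0 a_disj p_cond p_chain) => // A k Apart.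
  have [|F AF] := partition_range_End Hcomplete Hccc _ Apart; first by exists b.
  by exists F; rewrite AF; have [+ _ _] := pD F k; apply; rewrite -AF.
(* The task for [h] puts some [y] in one filter and the complement of [h y] in the other. *)
have notM i : ~ le_M (tower_filter p i) (tower_filter p (~~ i)).
  move=> [v [h [Vv [hom UV]]]].
  have [_ [V0 [_ [VI _]]]] := ultra (~~ i).
  have hE : isEnd h.
    by exists v; split=> //; rewrite lt0x; apply/eqP => v0; case: V0; rewrite -v0.
  have [_ _ [y [yU yV]]] := pD (fun=> exist _ h hE) i.
  have Uy : tower_filter p i y by exists (fun=> exist _ h hE).
  have Vn : tower_filter p (~~ i) (~` h y) by exists (fun=> exist _ h hE).
  by apply: V0; rewrite -(meetxC (h y)); apply: VI => //; apply/UV.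
exists (tower_filter p true), (tower_filter p false).
split; first exact: ultra.
split; first exact: ultra.
split; first exact: JPR.
split; first exact: JPR.
by split; [exact: (notM true) | exact: (notM false)].
Qed.
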